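(* Let $m<8$ be a real number, let $M(h)=h^m$, and fix $T>0$. Then there exists a curve $[-T,0]\ni t\mapsto h_t$ of film heights on $\mathbb R$ such that $$I_T(h)<\infty,\qquad \min_{x\in\mathbb R}h_{-T}(x)>0,\qquad \min_{x\in\mathbb R}h_0(x)=0 .$$
   Context: Everything is posed on the whole line $\mathbb R$ (no periodicity and no mass normalization). A curve of film heights on $[-T,0]$ is a family of functions $h_t:\mathbb R\to[0,\infty)$, continuous in $t\in[-T,0]$ with respect to locally uniform convergence, with $h_t>0$ for $t\in[-T,0)$, and sufficiently smooth in $(t,x)$ for $t\in[-T,0)$ that the expressions below make sense; the terminal state $h_0$ may touch zero. For a positive function $h$ and a tangent vector $\dot h:\mathbb R\to\mathbb R$, the metric tensor is $$g_h(\dot h,\dot h)=\inf_j\Big\{\int_{\mathbb R}\frac{j^2}{M(h)}\,dx:\ \partial_xj+\dot h=0\Big\}.$$ The energy is the Dirichlet energy $E(h)=\frac12\int_{\mathbb R}(\partial_xh)^2dx$, and its gradient with respect to $g$ is $\nabla E(h)=\partial_x(M(h)\partial_x^3h)$. The rate functional of the curve is $$I_T(h)=\frac12\int_{-T}^0g_{h_t}\big(\partial_th_t+\nabla E(h_t),\,\partial_th_t+\nabla E(h_t)\big)\,dt .$$ *)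

(* Defs.v *)
From HB Require Import structures.
From mathcomp Require Import all_boot all_order all_algebra.
From mathcomp Require Import all_classical all_reals all_analysis.
Import Order.TTheory GRing.Theory Num.Theory.
Import numFieldNormedType.Exports.

Set Implicit Arguments.
Unset Strict Implicit.
Unset Printing Implicit Defensive.

Local Open Scope ring_scope.
Local Open Scope classical_set_scope.

Section ThinFilm.
Context {R : realType}.
Implicit Types (M f hdot : R -> R) (h : R -> R -> R) (T : R).

Definition power_mobility (m : R) : R -> R := fun a => a `^ m.

Definition min_value f (v : R) : Prop := range f v /\ lbound (range f) v.

(* Each admissible flux j is required to solve j' = - hdot classically; when
   hdot is continuous, as it is along the curves below, this loses no
   distributional solution.  The infimum is +oo when there is no admissible
   flux. *)
Definition metric_tensor M f hdot : \bar R :=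
  ereal_inf [set (\int[lebesgue_measure]_x ((j x) ^+ 2 / M (f x))%:E)%E
            | j in [set j : R -> R | forall x : R, is_derive x 1 j (- hdot x)]].

(* The gradient, for metric_tensor M, of the Dirichlet energy
   E(f) = 1/2 \int (f')^2 dx. *)
Definition grad_energy M f : R -> R :=
  (fun x : R => M (f x) * f^`(3)%classic x)^`().

(* A curve is represented by a total function of time, of which only the values
   on [-T, 0] matter.  Time derivatives are therefore taken along [-T, 0[; in
   particular the one at -T is one-sided. *)
Definition time_quotient h (t x : R) : R -> R :=
  fun s => (h s x - h t x) / (s - t).

Definition time_derivative T h (t x : R) : R :=
  lim (time_quotient h t x @ within `[- T, 0[ (dnbhs t)).

(* C^1 in time and C^4 in space, jointly, on [-T, 0[ x R: this is what the
   classical reading of d_t h_t + grad E(h_t) uses. *)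
Definition smooth_curve T h : Prop :=
  [/\ forall t x : R, - T <= t < 0 ->
        cvg (time_quotient h t x @ within `[- T, 0[ (dnbhs t)),
      forall (n : nat) (t x : R), (n < 4)%N -> - T <= t < 0 ->
        derivable (h t)^`(n)%classic x 1,
      {within `[- T, 0[ `*` setT,
        continuous (fun p : R * R => time_derivative T h p.1 p.2)} &
      forall n : nat, (n <= 4)%N ->
        {within `[- T, 0[ `*` setT,
          continuous (fun p : R * R => (h p.1)^`(n)%classic p.2)}].

Definition film_curve T h : Prop :=
  [/\ forall t x : R, - T <= t <= 0 -> 0 <= h t x,
      {within `[- T, 0], continuous (h : R -> {family compact, R -> R})},
      forall t x : R, - T <= t < 0 -> 0 < h t x &
      smooth_curve T h].

(* The integrand has no meaning at the single time t = 0, where the film may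
   touch zero, hence the half-open domain of integration. *)
Definition rate_functional M T h : \bar R :=
  ((2^-1)%:E * \int[lebesgue_measure]_(t in `[(- T)%R, 0%R[)
     metric_tensor M (h t)
       (fun x => time_derivative T h t x + grad_energy M (h t) x)%R)%E.

End ThinFilm.

(* Main.v *)
Require Import Defs.
From HB Require Import structures.
From mathcomp Require Import all_boot all_order all_algebra.
From mathcomp Require Import all_classical all_reals all_analysis.
From mathcomp Require Import measurable_realfun ring lra.
Import Order.TTheory GRing.Theory Num.Theory.
Import numFieldNormedType.Exports.

(** With tau = - t, n a large even integer, a slightly above 1/2 and
    eps = tau^(n b), take
      h_t = d/dx [x (eps + x^n)^(a/n)],
    a smoothing of (1 + a) |x|^a at the length scale tau^b.  Since h_t is an
    x-derivative, d_t h_t has the explicit primitive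
    K = d/dt [x (eps + x^n)^(a/n)], so that j = - (M(h) h''' + K) is an
    admissible flux, and K decays at infinity as fast as desired when n grows.
    With rho = (eps + x^n)^(1/n), which is comparable to tau^b + |x|, one has
    h ~ rho^a, h''' = O(rho^(a - 3)) and K = eps' O(rho^(1 + a - n)), hence
      j^2 / M(h) = O(rho^(a m + 2 a - 6) + eps'^2 rho^(2 + 2 a - 2 n - a m)).
    Integrating in x and inserting b = 1 / (4 - a m) bounds the metric tensor
    by a sum of powers of tau, which are integrable as soon as 1/2 < a and
    a (m + 2) < 5.  For m < 8 the value a = (18 - m) / 20 qualifies, and both
    powers are then equal to - (8 - m) / (10 - m) > - 1. *)

Local Open Scope ring_scope.
Local Open Scope classical_set_scope.

(** * Monotonicity and continuity of real powers *)

Section RealPowers.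
Context {R : realType}.

Lemma powR_antitone (p x y : R) : p <= 0 -> 0 < x -> x <= y -> y `^ p <= x `^ p.
Proof.
move=> p0 x0 xy; have y0 := lt_le_trans x0 xy.
have E z : z `^ p = (z `^ (- p))^-1 by rewrite -powRN opprK.
rewrite (E x) (E y) lef_pV2 ?posrE ?powR_gt0//.
by apply: ge0_ler_powR; rewrite ?nnegrE ?oppr_ge0// ltW.
Qed.

(** The absolute value in the exponent of [c] treats both signs of [p] at once, so that mobilities
    with negative exponent and reciprocals of mobilities are covered. *)
Lemma powR_comparable (p c y z : R) : 1 <= c -> 0 < y -> y <= z -> z <= c * y ->
  z `^ p <= c `^ `|p| * y `^ p.
Proof.
move=> c1 y0 yz zc.
have c0 : 0 <= c by rewrite (le_trans _ c1).
have z0 : 0 < z by exact: lt_le_trans yz.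
have [p0|p0] := leP 0 p.
  rewrite ger0_norm// -powRM ?(ltW y0)//.
  by apply: ge0_ler_powR; rewrite ?nnegrE ?mulr_ge0// ltW.
apply: (@le_trans _ _ (y `^ p)).
  by apply: powR_antitone => //; exact: ltW.
have : c `^ 0 <= c `^ `|p| by apply: ler_powR.
by rewrite powRr0; apply: ler_peMl; exact: powR_ge0.
Qed.

Lemma continuous_powR_pos (p : R) (f : R -> R) :
  continuous f -> (forall x, 0 < f x) -> continuous (fun x => f x `^ p).
Proof.
move=> cf f0 x; apply: (@continuous_comp _ _ _ f (@powR R ^~ p)); first exact: cf.
apply: differentiable_continuous; apply/derivable1_diffP.
by apply: derivable_powR; rewrite in_itv/= andbT.
Qed.

Lemma is_derive_powR_opp p (t : R) : t < 0 ->
  is_derive t 1 (fun t : R => (- t) `^ p) (- (p * (- t) `^ (p - 1))).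
Proof.
move=> t0; have nt0 : 0 < - t by rewrite oppr_gt0.
have dN : is_derive t (1:R) (fun t : R => - t) (-1) by exact: is_deriveN.
have := @is_derive1_comp R (@powR R ^~ p) (fun t =>
  - t) t _ _ (is_derive1_powR p nt0) dN.
by rewrite mulrN1.
Qed.

Lemma continuous_powR_opp p (t : R) : t < 0 ->
  {for t, continuous (fun t : R => (- t) `^ p)}.
Proof.
move=> t0; apply: differentiable_continuous; apply/derivable1_diffP.
by have [] := is_derive_powR_opp p t t0.
Qed.

Lemma within_continuous_powR_opp (T b : R) : 0 < b ->
  {within `[- T, 0], continuous (fun t : R => (- t) `^ b)}.
Proof.
move=> b_gt0.
apply/subspace_continuousP => t /=; rewrite in_itv/= => /andP[Tt].
rewrite le_eqVlt => /predU1P[->|t0]; last first.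
  have := continuous_powR_opp b t t0.
  by apply: cvg_trans; apply: cvg_fmap2; exact: cvg_within.
rewrite /from_subspace oppr0 powR0 ?gt_eqF//.
apply/cvgr0Pnorm_lt => e e0.
(* Only t = 0 is delicate; there the radius e^(1/b) inverts the power. *)
have d0 : 0 < e `^ b^-1 by rewrite powR_gt0.
rewrite near_withinE; near=> u.
rewrite /= in_itv/= => /andP[_ u0].
rewrite ger0_norm ?powR_ge0//.
rewrite [ltRHS](_ : _ = (e `^ b^-1) `^ b); last first.
  by rewrite -powRrM mulVf ?gt_eqF// powRr1// ltW.
apply: gt0_ltr_powR; rewrite ?nnegrE ?powR_ge0 ?oppr_ge0//.
rewrite -(ler0_norm u0).
near: u.
have H : \forall u \near (0 : R), `|u| < e `^ b^-1 by exact: nbhs0_lt.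
exact: H.
Unshelve. all: by end_near. Qed.

End RealPowers.

(** * Symbolic calculus of sums of c x^i (e + x^n)^p *)

Section Monomials.
Context {R : realType}.
Variable n : nat.
Hypotheses (n_gt0 : (0 < n)%N) (n_even : ~~ odd n).
Implicit Types (l : seq (R * nat * R)) (e x : R).

(** Finite sums of these monomials are closed under differentiation in x and in e. Encoding them as
    lists turns derivatives of every order into list operations, and size estimates into bookkeeping
    of weights. *)
Definition mono (z : R * nat * R) e x : R :=
  z.1.1 * x ^+ z.1.2 * (e + x ^+ n) `^ z.2.

Definition msum l e x : R := \sum_(z <- l) mono z e x.

Definition dx l : seq (R * nat * R) :=
  flatten [seq [:: (z.1.1 * z.1.2%:R, z.1.2.-1, z.2);
                   (z.1.1 * z.2 * n%:R, (z.1.2 + n.-1)%N, z.2 - 1)] | z <- l].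

Definition de l : seq (R * nat * R) :=
  [seq (z.1.1 * z.2, z.1.2, z.2 - 1) | z <- l].

(* The monomials of [homog d l] have weight [d] when [x] has weight 1 and [e]
   weight [n]; those with zero coefficient are exempt because [dx] sends
   [x ^+ 0] to a null multiple of [x ^+ 0.-1 = x ^+ 0]. *)
Definition homog (d : R) l : bool :=
  all (fun z => (z.1.1 == 0) || (z.1.2%:R + n%:R * z.2 == d)) l.

Lemma dx_cons z l : dx (z :: l) =
  [:: (z.1.1 * z.1.2%:R, z.1.2.-1, z.2),
      (z.1.1 * z.2 * n%:R, (z.1.2 + n.-1)%N, z.2 - 1) & dx l].
Proof. by []. Qed.

(** Mixed partials commute already as lists. This identifies the x-derivative of the explicit
    primitive K with the time derivative of the film. *)
Lemma dx_de l : dx (de l) = de (dx l).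
Proof.
elim: l => // -[[c i] p] l IH; rewrite /= !dx_cons IH.
by congr [:: (_, _, _), (_, _, _) & _]; rewrite /=; ring.
Qed.

Lemma homog_dx d l : homog d l -> homog (d - 1) (dx l).
Proof.
elim: l => // -[[c i] p] l IH; rewrite dx_cons /= => /andP[zd /IH->].
rewrite andbT.
case/orP: zd => [/eqP->|/eqP <-]; first by rewrite !mul0r eqxx.
apply/andP; split; apply/orP.
  case: i => [|i]; first by left; rewrite mulr0.
  by right; apply/eqP; rewrite /= -addn1 natrD; ring.
right; apply/eqP.
rewrite natrD -subn1 natrB//; ring.
Qed.

Lemma homog_de d l : homog d l -> homog (d - n%:R) (de l).
Proof.
elim: l => // -[[c i] p] l IH /= /andP[zd /IH->]; rewrite andbT.
case/orP: zd => [/eqP->|/eqP <-]; first by rewrite mul0r eqxx.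
by apply/orP; right; apply/eqP; ring.
Qed.

Lemma even_expr_ge0 x : 0 <= x ^+ n.
Proof. exact: exprn_even_ge0. Qed.

Lemma base_gt0 {e x} : 0 < e -> 0 < e + x ^+ n.
Proof. by move=> e0; rewrite ltr_wpDr// even_expr_ge0. Qed.

Lemma is_derive_exprn i x :
  is_derive x (1 : R) (fun y : R => y ^+ i) (i%:R * x ^+ i.-1).
Proof.
have := @is_deriveX R R id i x 1 1 (is_derive_id x 1).
by rewrite exprfctE /GRing.scale/= mulr1.
Qed.

Lemma is_derive_mono_x z e x : 0 < e ->
  is_derive x 1 (mono z e)
    (mono (z.1.1 * z.1.2%:R, z.1.2.-1, z.2) e x +
     mono (z.1.1 * z.2 * n%:R, (z.1.2 + n.-1)%N, z.2 - 1) e x).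
Proof.
case: z => [[c i] p] e0; rewrite /mono /=.
have w0 := @base_gt0 e x e0.
have dw : is_derive x (1:R) (fun y : R => e + y ^+ n) (n%:R * x ^+ n.-1).
  apply: (is_derive_eq (is_deriveD (is_derive_cst e x 1) (is_derive_exprn n x))).
  by rewrite add0r.
have dp := @is_derive1_comp R (@powR R ^~ p) (fun y =>
  e + y ^+ n) x _ _ (is_derive1_powR p w0) dw.
have dxi : is_derive x (1:R) (fun y : R => c * y ^+ i) (c * (i%:R * x ^+ i.-1)).
  exact: (is_deriveZ c (is_derive_exprn i x)).
apply: (is_derive_eq (is_deriveM dxi dp)).
rewrite /GRing.scale/= exprD; ring.
Qed.

Lemma is_derive_mono_e c i p e x : 0 < e ->
  is_derive e 1 (fun e => mono (c, i, p) e x) (mono (c * p, i, p - 1) e x).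
Proof.
move=> e0; rewrite /mono /=.
have w0 := @base_gt0 e x e0.
have dw : is_derive e (1:R) (fun e : R => e + x ^+ n) 1.
  apply: (is_derive_eq (is_deriveD (is_derive_id e 1) (is_derive_cst (x ^+ n) e 1))).
  by rewrite addr0.
have dp := @is_derive1_comp R (@powR R ^~ p) (fun y =>
  y + x ^+ n) e _ _ (is_derive1_powR p w0) dw.
apply: (is_derive_eq (is_deriveZ (c * x ^+ i) dp)).
rewrite /GRing.scale/=; ring.
Qed.

Lemma msum_cons z l e x : msum (z :: l) e x = mono z e x + msum l e x.
Proof. exact: big_cons. Qed.

Lemma is_derive_msum_x l e x : 0 < e ->
  is_derive x 1 (msum l e) (msum (dx l) e x).
Proof.
move=> e0; elim: l => [|z l IH].
  rewrite {2}/msum big_nil.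
  rewrite (_ : msum [::] e = cst 0); first exact: is_derive_cst.
  by apply/funext => y; rewrite /msum big_nil.
rewrite dx_cons 2!msum_cons addrA.
rewrite (_ : msum (z :: l) e = mono z e + msum l e); last first.
  by apply/funext => y; rewrite msum_cons.
exact: is_deriveD (is_derive_mono_x z e x e0) IH.
Qed.

Lemma derive1n_msum i l (e : R) : 0 < e ->
  (msum l e)^`(i)%classic = msum (iter i dx l) e.
Proof.
move=> e0; elim: i => // i IH; rewrite derive1nS IH; apply/funext => x.
rewrite derive1E.
by have [_ ->] := is_derive_msum_x (iter i dx l) e x e0.
Qed.

Lemma is_derive_msum_e l e x : 0 < e ->
  is_derive e 1 (fun e => msum l e x) (msum (de l) e x).
Proof.
move=> e0; elim: l => [|[[c i] p] l IH].
  rewrite {2}/msum big_nil.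
  rewrite (_ : (fun e => msum [::] e x) = cst 0); first exact: is_derive_cst.
  by apply/funext => y; rewrite /msum big_nil.
rewrite /= msum_cons.
rewrite (_ : (fun e => msum ((c, i, p) :: l) e x) =
  (fun e => mono (c, i, p) e x) + (fun e => msum l e x)); last first.
  by apply/funext => y; rewrite msum_cons.
exact: is_deriveD (is_derive_mono_e c i p e x e0) IH.
Qed.

Lemma continuous_msum l (e x : R) : 0 < e ->
  {for (e, x), continuous (fun q : R * R => msum l q.1 q.2)}.
Proof.
move=> e0; elim: l => [|[[c i] p] l IH].
  rewrite (_ : (fun q => msum [::] q.1 q.2) = cst 0); first exact: cvg_cst.
  by apply/funext => y; rewrite /msum big_nil.
rewrite (_ : (fun q => msum ((c, i, p) :: l) q.1 q.2) =
  (fun q => mono (c, i, p) q.1 q.2) \+ (fun q => msum l q.1 q.2)); last first.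
  by apply/funext => y; rewrite msum_cons.
apply: continuousD => //; rewrite /mono /=.
have w0 := @base_gt0 e x e0.
have cX j : {for (e, x), continuous (fun q : R * R => q.2 ^+ j)}.
  apply: (@continuous_comp _ _ _ (@snd R R) (fun y => y ^+ j)).
    exact: cvg_snd.
  exact: exprn_continuous.
apply: continuousM.
  by apply: continuousM; [exact: cvg_cst|exact: cX].
apply: (@continuous_comp _ _ _ (fun q : R * R => q.1 + q.2 ^+ n) (@powR R ^~ p)).
  by apply: continuousD; [exact: cvg_fst|exact: cX].
apply: differentiable_continuous; apply/derivable1_diffP.
by apply: derivable_powR; rewrite in_itv/= andbT.
Qed.

(** As n is even, |x| is at most (e + x^n)^(1/n); replacing each |x|^i accordingly leaves the
    exponent i/n + p, which is d/n for every monomial with nonzero coefficient. *)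
Lemma msum_bound d l e x : 0 < e -> homog d l ->
  `|msum l e x| <= (\sum_(z <- l) `|z.1.1|) * (e + x ^+ n) `^ (d / n%:R).
Proof.
move=> e0; have w0 := @base_gt0 e x e0.
have n0 : n%:R != 0 :> R by rewrite pnatr_eq0 -lt0n.
elim: l => [|[[c i] p] l IH]; first by rewrite /msum !big_nil normr0 mul0r.
move=> /= /andP[zd /IH {}IH].
rewrite msum_cons big_cons mulrDl (le_trans (ler_normD _ _))// lerD//.
rewrite /mono /=; case/orP: zd => [/eqP->|/eqP <-].
  by rewrite !mul0r normr0 mul0r.
rewrite mulrDl [n%:R * p]mulrC mulfK// powRD; last first.
  by apply/implyP => _; rewrite gt_eqF.
rewrite !normrM (ger0_norm (powR_ge0 _ _)) -mulrA ler_wpM2l// ler_wpM2r ?powR_ge0//.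
rewrite normrX mulrC powRrM powR_mulrn ?powR_ge0//; apply: lerXn2r;
  rewrite ?nnegrE ?powR_ge0//.
rewrite -[leLHS](_ : (`|x| `^ n%:R) `^ (n%:R^-1) = `|x|); last first.
  by rewrite -powRrM divff// powRr1.
rewrite powR_mulrn// -normrX ger0_norm ?even_expr_ge0//.
apply: ge0_ler_powR; rewrite ?invr_ge0 ?nnegrE ?even_expr_ge0 ?lerDr//.
  exact: ltW.
exact: ltW.
Qed.

End Monomials.

(** * Integrals of powers in space and in time *)

Section Integrals.
Context {R : realType}.
Notation mu := (@lebesgue_measure R).

(* [ge0_le_integral] asks for measurability, which is unclear for the metric
   tensor as a function of time, an infimum over uncountably many fluxes. *)
Lemma ge0_le_integral_nonmeasurable d (X : measurableType d)
    (nu : {measure set X -> \bar R}) (D : set X) (f g : X -> \bar R) :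
  (forall x, D x -> 0 <= f x)%E -> (forall x, D x -> f x <= g x)%E ->
  (\int[nu]_(x in D) f x <= \int[nu]_(x in D) g x)%E.
Proof.
move=> f0 fg; rewrite !ge0_integralE//; last first.
  by move=> x Dx; exact: le_trans (f0 x Dx) (fg x Dx).
apply: le_ereal_sup => _ [u /= uf <-]; exists u => //= x.
by rewrite (le_trans (uf x))// lee_restrict.
Qed.

Lemma integral_powR_abs (A q : R) : 0 < A -> 1 < q ->
  (\int[mu]_x ((A + `|x|) `^ (- q))%:E = (2 * (A `^ (1 - q) / (q - 1)))%:E)%E.
Proof.
move=> A0 q1.
have pos (x : R) : 0 < A + `|x| by rewrite ltr_wpDr.
have cf : continuous (fun x : R => (A + `|x|) `^ (- q)).
  apply: continuous_powR_pos => // x; apply: continuousD; first exact: cvg_cst.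
  exact: norm_continuous.
rewrite ge0_symfun_integralT//; last 2 first.
- by move=> x; exact: powR_ge0.
- by move=> x /=; rewrite normrN.
rewrite EFinM; congr (_ * _)%E.
rewrite -set_itvcy.
(* The value is written as the limit at infinity minus the value at 0 of the primitive [F]. *)
rewrite (_ : (A `^ (1 - q) / (q - 1))%:E = 0%:E - (- (A `^ (1 - q) / (q - 1)))%:E)%E;
  last first.
  by rewrite -EFinB sub0r opprK.
pose F (x : R) := - ((A + x) `^ (1 - q) / (q - 1)).
have dF (x : R) : 0 <= x -> is_derive x 1 F ((A + `|x|) `^ (- q)).
  move=> x0; have Ax : 0 < A + x by rewrite ltr_wpDr.
  have dw : is_derive x (1:R) (fun y : R => A + y) 1.
    apply: (is_derive_eq (is_deriveD (is_derive_cst A x 1) (is_derive_id x 1))).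
    by rewrite add0r.
  have dp := @is_derive1_comp R (@powR R ^~ (1 - q)) (fun y =>
    A + y) x _ _ (is_derive1_powR _ Ax) dw.
  rewrite (_ : F = (- (q - 1)^-1) *: ((@powR R ^~ (1 - q)) \o (fun y => A + y)));
    last first.
    by apply/funext => y; rewrite /F /GRing.scale/= /GRing.scale/=; ring.
  apply: (is_derive_eq (is_deriveZ _ dp)).
  rewrite ger0_norm// /GRing.scale/= mulr1 (_ : 1 - q - 1 = - q); last by ring.
  have : q - 1 != 0 by rewrite subr_eq0 gt_eqF.
  by move=> ?; field.
rewrite -[X in (_ - X%:E)%E](_ : F 0 = _); last by rewrite /F addr0.
apply: ge0_continuous_FTC2y.
- by move=> x _; exact: powR_ge0.
- exact: continuous_subspaceT.
- rewrite -oppr0; apply: cvgN; rewrite -(mul0r (q - 1)^-1); apply: cvgMl.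
  apply/cvgr0Pnorm_le => e e0.
  near=> x.
  (* This threshold y solves y^(1 - q) = e. *)
  have y0 : 0 < e `^ (- (q - 1)^-1) by exact: powR_gt0.
  have yx : e `^ (- (q - 1)^-1) <= x by near: x; apply: nbhs_pinfty_ge;
    rewrite num_real.
  have Ax : e `^ (- (q - 1)^-1) <= A + x by rewrite (le_trans yx)// lerDr ltW.
  rewrite ger0_norm ?powR_ge0// -opprB powRN.
  rewrite -[leRHS]invrK lef_pV2 ?posrE ?invr_gt0//; last first.
    by rewrite powR_gt0// (lt_le_trans y0).
  rewrite (_ : e^-1 = (e `^ (- (q - 1)^-1)) `^ (q - 1)).
    apply: ge0_ler_powR; rewrite ?nnegrE ?powR_ge0 ?subr_ge0 ?(ltW q1)//.
    by rewrite (le_trans (ltW y0)).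
  rewrite -powRrM mulNr mulVf ?powR_inv1 ?ltW//.
  by rewrite subr_eq0 gt_eqF.
- by move=> x x0; have [] := dF x (ltW x0).
- apply: cvg_at_right_filter; have [d0 _] := dF 0 (lexx _).
  by apply: differentiable_continuous; apply/derivable1_diffP.
- move=> x; rewrite in_itv/= andbT => x0.
  by rewrite derive1E; have [_ ->] := dF x (ltW x0); rewrite ger0_norm ?ltW.
Unshelve. all: by end_near. Qed.

(** The integrand may blow up at 0, so the interval is exhausted by compact ones: on each, the
    primitive gives the bound once the boundary term near 0 is dropped, and monotone convergence
    concludes. *)
Lemma integral_powR_time_le (T r : R) : 0 < T -> -1 < r ->
  (\int[mu]_(t in `[(- T)%R, 0%R[) ((- t) `^ r)%:E <= (T `^ (r + 1) / (r + 1))%:E)%E.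
Proof.
move=> T0 r1.
have r0 : 0 < r + 1 by lra.
(* The shift by 2 keeps every interval nondegenerate, including the one for i = 0. *)
pose D (i : nat) : set R := `[- T, - (T / i.+2%:R)].
have DE : `[(- T)%R, 0%R[%classic = \bigcup_i D i.
  apply/seteqP; split => t /=; rewrite in_itv/=.
    move=> /andP[Tt t0]; exists (Num.truncn (T / - t)) => //.
    rewrite /D /= in_itv/= Tt /= lerNr ler_pdivrMr// mulrC -ler_pdivrMr ?oppr_gt0//.
    by rewrite (le_trans (ltW (truncnS_gt _)))// ler_nat.
  move=> [i _]; rewrite /D /= in_itv/= => /andP[-> ti] /=.
  by rewrite (le_lt_trans ti)// oppr_lt0 divr_gt0.
have Dneg i t : D i t -> t < 0.
  rewrite /D /= in_itv/= => /andP[_ /le_lt_trans]; apply.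
  by rewrite oppr_lt0 divr_gt0.
have mD i : measurable (D i) by exact: measurable_itv.
have cD i p : {within D i, continuous (fun t : R => (- t) `^ p)}.
  by apply: continuous_in_subspaceT => t; rewrite inE => /Dneg;
    exact: continuous_powR_opp.
have mf i : measurable_fun (D i) (fun t : R => (- t) `^ r).
  exact: subspace_continuous_measurable_fun (mD i) (cD i r).
have cvgD : (\int[mu]_(t in D i) ((- t) `^ r)%:E @[i --> \oo] -->
   \int[mu]_(t in \bigcup_i D i) ((- t) `^ r)%:E)%E.
  apply: ge0_nondecreasing_set_cvg_integral => //.
  - move=> i j ij; rewrite subsetEset /D => t /=; rewrite !in_itv/= => /andP[-> ti] /=.
    rewrite (le_trans ti)// lerN2 ler_pM2l// lef_pV2 ?posrE//.
    by rewrite ler_nat.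
  - by move=> i; apply/measurable_EFinP; exact: mf.
  - by move=> i t _; rewrite lee_fin powR_ge0.
rewrite DE -(cvg_lim _ cvgD)//; apply: lime_le; first by apply/cvg_ex; eexists;
  exact: cvgD.
apply: nearW => i; rewrite /D.
pose F (t : R) := - ((- t) `^ (r + 1) / (r + 1)).
have dF (t : R) : t < 0 -> is_derive t 1 F ((- t) `^ r).
  move=> t0.
  rewrite (_ : F = (- (r + 1)^-1) *: (fun t : R => (- t) `^ (r + 1))); last first.
    by apply/funext => y; rewrite /F /GRing.scale/= /GRing.scale/=; ring.
  apply: (is_derive_eq (is_deriveZ _ (is_derive_powR_opp (r + 1) t t0))).
  rewrite addrK /GRing.scale/=.
  by have : r + 1 != 0 by [rewrite gt_eqF]; move=> ?; field.
have Ti : T / i.+2%:R < T by rewrite ltr_pdivrMr// ltr_pMr// ltr1n.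
have Ti0 : - (T / i.+2%:R) < 0 by rewrite oppr_lt0 divr_gt0.
rewrite (@continuous_FTC2 _ _ F)//.
- rewrite -EFinB lee_fin /F !opprK addrC gerBl.
  by rewrite divr_ge0 ?powR_ge0// ltW.
- by rewrite ltrN2.
- exact: cD.
- have cF (t : R) : t < 0 -> {for t, continuous F}.
    move=> t0; apply: differentiable_continuous; apply/derivable1_diffP.
    by have [] := dF t t0.
  split.
  + move=> t; rewrite in_itv/= => /andP[_ /lt_trans /(_ Ti0) t0].
    by have [] := dF t t0.
  + by apply: cvg_at_right_filter; apply: cF; rewrite oppr_lt0.
  + by apply: cvg_at_left_filter; apply: cF.
- move=> t; rewrite in_itv/= => /andP[_ /lt_trans /(_ Ti0) t0].
  by rewrite derive1E; have [_ ->] := dF t t0.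
Qed.
End Integrals.

(** * Identification of the time derivative along the half-open interval *)

Section TimeDerivative.
Context {R : realType}.
Variables (T : R) (h : R -> R -> R) (t x d : R).
Hypotheses (Tt : - T <= t < 0) (dh : is_derive t 1 (h ^~ x) d).

Lemma time_quotient_cvg :
  time_quotient h t x @ within `[- T, 0[ (dnbhs t) --> d.
Proof.
suff : time_quotient h t x @ dnbhs t --> d.
  by apply: cvg_trans; apply: cvg_fmap2; exact: cvg_within.
have [dt <-] := dh; move: dt => /cvgrPdist_lt dt.
apply/cvgrPdist_lt => e e0; have [r /= r0 Hr] := dt e e0.
exists r => //= s /= st nst.
have st' : ball_ Num.norm 0 r (s - t) by rewrite /= sub0r normrN distrC.
have nst' : s - t != 0 by rewrite subr_eq0; exact: nst.
have := Hr _ st' nst'.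
rewrite /time_quotient /= [_%:A]mulr1 subrK.
by rewrite /GRing.scale/= mulrC.
Qed.

Lemma time_derivativeE : time_derivative T h t x = d.
Proof.
have [Tt1 t0] := andP Tt.
(* Uniqueness of the limit needs a proper filter: every t, even -T, is approached from the right
   inside the interval. *)
have PF : ProperFilter (within `[- T, 0[ (dnbhs t)).
  apply: Build_ProperFilter_ex => P tP.
  have tP' : \forall s \near t^'+, - T <= s < 0 -> P s.
    have nP : nbhs t (fun s : R => s != t -> `[- T, 0[%classic s -> P s) := tP.
    suff : nbhs t (fun s : R => t < s -> - T <= s < 0 -> P s) by [].
    apply: filterS nP => s Ps ts Ds; apply: Ps; first by rewrite gt_eqF.
    by rewrite /= in_itv.
  have : \forall s \near t^'+, P s.
    near=> s.
    have : - T <= s < 0 -> P s by near: s.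
    apply; apply/andP; split; first by rewrite (le_trans Tt1)// ltW.
    by near: s; apply: nbhs_right_lt.
  by move=> /filter_ex[s Ps]; exists s.
exact: cvg_lim time_quotient_cvg.
Unshelve. all: by end_near. Qed.

End TimeDerivative.

(** * Smoothness of curves t -> [msum n l (eps t)] *)

Section SmoothFilm.
Context {R : realType}.
Variable n : nat.
Hypotheses (n_gt0 : (0 < n)%N) (n_even : ~~ odd n).
Variables (T : R) (eps deps : R -> R) (l : seq (R * nat * R)).
Hypothesis eps_gt0 : forall t : R, t < 0 -> 0 < eps t.
Hypothesis is_derive_eps : forall t : R, t < 0 -> is_derive t 1 eps (deps t).
Hypothesis continuous_deps : forall t : R, t < 0 -> {for t, continuous deps}.

Let h (t x : R) : R := msum n l (eps t) x.

Lemma is_derive_film_t (t x : R) : t < 0 ->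
  is_derive t 1 (h ^~ x) (deps t * msum n (de l) (eps t) x).
Proof.
move=> t0; have := (@is_derive1_comp R (fun e => msum n l e x) eps t _ _
  (is_derive_msum_e n n_even l (eps t) x (eps_gt0 t t0)) (is_derive_eps t t0)).
by rewrite mulrC.
Qed.

Lemma continuous_film l' (t x : R) : t < 0 ->
  {for (t, x), continuous (fun p : R * R => msum n l' (eps p.1) p.2)}.
Proof.
move=> t0.
have ceps : {for t, continuous eps}.
  apply: differentiable_continuous; apply/derivable1_diffP.
  by have [] := is_derive_eps t t0.
apply: (@continuous2_cvg _ _ _ _ (nbhs (t, x)) _ (eps \o fst) snd (msum n l')
  (eps t) x).
- exact: (continuous_msum n n_even l' (eps t) x (eps_gt0 t t0)).
- by apply: (@continuous_comp _ _ _ (@fst R R) eps (t, x));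
  [exact: cvg_fst|exact: ceps].
- exact: cvg_snd.
Qed.

Lemma smooth_film : smooth_curve T h.
Proof.
have ltT (t : R) : - T <= t < 0 -> t < 0 by case/andP.
split.
- move=> t x tT; apply/cvg_ex; eexists.
  exact: time_quotient_cvg (is_derive_film_t t x (ltT _ tT)).
- move=> i t x _ /ltT t0; rewrite derive1n_msum//; last exact: eps_gt0.
  by have [] := is_derive_msum_x n n_even (iter i (dx n) l) (eps t) x (eps_gt0 t t0).
- apply: (@subspace_eq_continuous _ _ _ (fun p : R * R =>
  deps p.1 * msum n (de l) (eps p.1) p.2)).
    move=> [t x]; rewrite inE /= => -[tT _]; apply/esym/time_derivativeE.
      by move: tT; rewrite in_itv.
    by apply: is_derive_film_t; move: tT; rewrite in_itv/= => /ltT.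
  apply: continuous_in_subspaceT => -[t x]; rewrite inE /= => -[];
    rewrite in_itv/= => /ltT t0 _.
  apply: (@continuousM R (R * R)%type (deps \o fst) (fun p =>
    msum n (de l) (eps p.1) p.2) (t, x)); last exact: continuous_film.
  apply: (@continuous_comp _ _ _ (@fst R R) deps); first exact: cvg_fst.
  exact: continuous_deps.
- move=> i _.
  apply: (@subspace_eq_continuous _ _ _ (fun p : R * R =>
    msum n (iter i (dx n) l) (eps p.1) p.2)).
    move=> [t x]; rewrite inE /= => -[]; rewrite in_itv/= => /ltT t0 _.
    exact: (congr1 (@^~ x) (esym (derive1n_msum n n_even i l (eps t) (eps_gt0 t t0)))).
  apply: continuous_in_subspaceT => -[t x]; rewrite inE /= => -[];
    rewrite in_itv/= => /ltT t0 _.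
  exact: continuous_film.
Qed.

End SmoothFilm.

(** * The film profile and its Hölder dependence on eps *)

Section Holder.
Context {R : realType}.

Variable n : nat.
Hypotheses (n_gt0 : (0 < n)%N) (n_even : ~~ odd n).

(** Here s = a/n. The profile is kept as [dx] of its antiderivative x (e + x^n)^s, from which the
    flux is read off. *)
Definition film (s e x : R) : R := msum n (dx n [:: (1, 1%N, s)]) e x.

Lemma filmE s e x :
  film s e x = (e + x ^+ n) `^ s + s * n%:R * (x ^+ n * (e + x ^+ n) `^ (s - 1)).
Proof.
rewrite /film dx_cons !msum_cons /msum /= big_nil /mono /= expr0 !mul1r add1n prednK//.
by ring.
Qed.

(** Both w^s and u w^(s - 1), with w = e + u and u = x^n, vary by at most |e1 - e2|^s. The constant
    is uniform in x and e = 0 is allowed, which gives continuity of the curve up to the terminal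
    time. *)
Lemma film_holder s e1 e2 x : 0 < s -> s <= 1 -> 0 <= e1 -> 0 <= e2 ->
  `|film s e1 x - film s e2 x| <= (1 + s * n%:R) * `|e1 - e2| `^ s.
Proof.
move=> s0 s1; wlog e12 : e1 e2 / e1 <= e2 => [H e10 e20|e10 e20].
  have [|/ltW] := leP e1 e2 => e12; first exact: H.
  by rewrite distrC [`|e1 - _|]distrC; exact: H.
rewrite !filmE distrC [`|e1 - _|]distrC.
have := @even_expr_ge0 R n n_even x; set u := x ^+ n => u0.
set w1 := e1 + u; set w2 := e2 + u; set d := e2 - e1; set a := s * n%:R.
have a0 : 0 <= a by rewrite mulr_ge0// ltW.
have d0 : 0 <= d by rewrite subr_ge0.
have w10 : 0 <= w1 by rewrite addr_ge0.
have w20 : 0 <= w2 by rewrite addr_ge0.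
have w12 : w1 <= w2 by rewrite lerD2r.
have uw1 : u <= w1 by rewrite lerDr.
have dw2 : d <= w2 by rewrite /d /w2; lra.
have wd : w2 = w1 + d by rewrite /w1 /w2 /d; ring.
have sm1 : s - 1 <= 0 by lra.
rewrite (ger0_norm d0).
(* The degenerate case e1 = u = 0: the power s - 1 of a vanishing base is multiplied by u = 0. *)
have [w1_eq0|w1_neq0] := eqVneq w1 0.
  have u_eq0 : u = 0 by lra.
  rewrite u_eq0 w1_eq0 !mul0r !mulr0 !addr0 powR0 ?gt_eqF// subr0.
  rewrite ger0_norm ?powR_ge0// wd w1_eq0 add0r ler_peMl ?powR_ge0//; lra.
have w1_gt0 : 0 < w1 by rewrite lt0r w1_neq0.
have w2_gt0 : 0 < w2 by exact: lt_le_trans w12.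
have P12 := powR_antitone (s - 1) w1 w2 sm1 w1_gt0 w12.
have P2d : d * w2 `^ (s - 1) <= d `^ s.
  rewrite -(mulr_powRB1 d0 s0).
  have [->|d_neq0] := eqVneq d 0; first by rewrite !mul0r.
  by apply: ler_wpM2l => //; apply: powR_antitone => //; rewrite lt0r d_neq0.
have mono_w : w1 `^ s <= w2 `^ s by apply: ge0_ler_powR; rewrite ?nnegrE// ltW.
move: mono_w; rewrite -(mulr_powRB1 w10 s0) -(mulr_powRB1 w20 s0).
move: P12 P2d (powR_ge0 w2 (s - 1)).
move: (w1 `^ _) (w2 `^ (s - 1)) (d `^ s) => P1 P2 D P12 P2d P20 A0.
have A_le : w2 * P2 - w1 * P1 <= D.
  apply: le_trans P2d; rewrite wd mulrDl.
  have : w1 * P2 <= w1 * P1 by apply: ler_wpM2l.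
  lra.
have B0 : 0 <= u * (P1 - P2) by rewrite mulr_ge0// subr_ge0.
(* Monotonicity of w^s reads w1 P1 <= (w1 + d) P2, hence w1 (P1 - P2) <= d P2 <= d^s. *)
have B_le : u * (P1 - P2) <= D.
  apply: (@le_trans _ _ (w1 * (P1 - P2))).
    by apply: ler_wpM2r => //; rewrite subr_ge0.
  apply: le_trans P2d; move: A0; rewrite wd; lra.
have aB0 : 0 <= a * (u * (P1 - P2)) by exact: mulr_ge0.
have aB_le : a * (u * (P1 - P2)) <= a * D by exact: ler_wpM2l.
have aD0 : 0 <= a * D by exact: le_trans aB_le.
rewrite ler_norml; apply/andP; split; lra.
Qed.

End Holder.

(** * From a Hölder bound uniform in x to locally uniform continuity in time *)

Section LocallyUniform.
Context {R : realType}.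
Variables (T s C : R) (eps : R -> R) (h : R -> R -> R).

Lemma locally_uniform_of_holder : 0 < s -> 0 <= C ->
  {within `[- T, 0], continuous eps} ->
  (forall t t' x : R, - T <= t <= 0 -> - T <= t' <= 0 ->
    `|h t x - h t' x| <= C * `|eps t - eps t'| `^ s) ->
  {within `[- T, 0], continuous (h : R -> {family compact, R -> R})}.
Proof.
move=> s0 C0 /subspace_continuousP ceps hh; apply/subspace_continuousP => t tT.
apply/fam_cvgP => K _ P /uniform_nbhs[E [entE EP]].
move: entE; rewrite -entourage_ballE => -[r /= r0 rE].
(* The radius inverts C d^s < r; [C + 1] replaces [C], which may vanish. *)
have d0 : 0 < (r / (C + 1)) `^ s^-1 by rewrite powR_gt0// divr_gt0//; lra.
have /cvgrPdist_lt /(_ _ d0) := ceps t tT.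
rewrite !near_simpl /=.
rewrite !near_withinE; apply: filterS => t' Ht' t'T; apply: EP => x _.
apply: rE => /=.
have tT' : - T <= t <= 0 by move: tT; rewrite /= in_itv.
have t'T' : - T <= t' <= 0 by move: t'T; rewrite /= in_itv.
apply: (le_lt_trans (hh _ _ _ tT' t'T')).
have : `|eps t - eps t'| `^ s < r / (C + 1).
  rewrite [ltRHS](_ : _ = ((r / (C + 1)) `^ s^-1) `^ s); last first.
    rewrite -powRrM mulVf ?gt_eqF// powRr1// divr_ge0//; lra.
  apply: gt0_ltr_powR; rewrite ?nnegrE ?powR_ge0//.
  exact: Ht'.
have C1 : 0 < C + 1 by lra.
rewrite ltr_pdivlMr// => H; apply: le_lt_trans H.
rewrite mulrC ler_wpM2l ?powR_ge0//; lra.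
Qed.

End LocallyUniform.

(** * The admissible flux and the bound on the metric tensor *)

Section Cost.
Context {R : realType}.
Notation mu := (@lebesgue_measure R).

Variable n : nat.
Hypotheses (n_gt0 : (0 < n)%N) (n_even : ~~ odd n).

Let n0 : 0 < n%:R :> R. Proof. by rewrite ltr0n. Qed.

Lemma continuous_powR_base (e p : R) : 0 < e ->
  continuous (fun x : R => (e + x ^+ n) `^ p).
Proof.
move=> e0; apply: (continuous_powR_pos p (fun x => e + x ^+ n)) => x;
  last exact: base_gt0.
by apply: (@continuousD _ _ _ (cst e) (fun y : R => y ^+ n) x);
  [exact: cvg_cst|exact: exprn_continuous].
Qed.

(** With A = e^(1/n), the length r = (e + x^n)^(1/n) dominates both A and |x|, so r^(-q) <= 2^q (A +
    |x|)^(-q), whose integral is explicit. *)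
Lemma integral_powR_base_le (q e : R) : 1 < q -> 0 < e ->
  (\int[mu]_x ((e + x ^+ n) `^ (- q / n%:R))%:E <=
   (2 `^ q * (2 * (e `^ ((1 - q) / n%:R) / (q - 1))))%:E)%E.
Proof.
move=> q1 e0; pose A := e `^ n%:R^-1.
have A0 : 0 < A by exact: powR_gt0.
have -> : e `^ ((1 - q) / n%:R) = A `^ (1 - q) by rewrite -powRrM mulrC.
rewrite EFinM -(integral_powR_abs A q)//.
rewrite -ge0_integralZl_EFin//; last 2 first.
- by move=> x _; rewrite lee_fin powR_ge0.
- apply/measurable_EFinP; apply: continuous_measurable_fun.
  apply: (continuous_powR_pos (- q) (fun x => A + `|x|)) => x; last by rewrite ltr_wpDr.
  by apply: (@continuousD _ _ _ (cst A) (fun y : R => `|y|) x);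
    [exact: cvg_cst|exact: norm_continuous].
apply: ge0_le_integral_nonmeasurable => x _; first by rewrite lee_fin powR_ge0.
have w0 := @base_gt0 R n n_even e x e0.
have x0 := @even_expr_ge0 R n n_even x.
rewrite -EFinM lee_fin mulrC powRrM.
set r := (e + x ^+ n) `^ n%:R^-1.
have r0 : 0 < r by exact: powR_gt0.
have Ar : A <= r by apply: ge0_ler_powR; rewrite ?invr_ge0 ?nnegrE ?lerDl// ltW.
have xr : `|x| <= r.
  rewrite [leLHS](_ : _ = (`|x| `^ n%:R) `^ (n%:R^-1)); last first.
    by rewrite -powRrM divff ?gt_eqF// powRr1.
  rewrite powR_mulrn// -normrX ger0_norm//.
  by apply: ge0_ler_powR; rewrite ?invr_ge0 ?nnegrE ?lerDr// ltW.
have : (2 * r) `^ (- q) <= (A + `|x|) `^ (- q).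
  by apply: powR_antitone; [lra|rewrite ltr_wpDr|lra].
rewrite powRM ?(ltW r0)// => H.
rewrite [leLHS](_ : _ = 2 `^ q * (2 `^ (- q) * r `^ (- q))); last first.
  by rewrite mulrA -powRD ?subrr ?powRr0 ?mul1r// eqxx pnatr_eq0.
by rewrite ler_wpM2l ?powR_ge0.
Qed.

Section Bound.
Variables (m s : R).
Hypothesis s_gt0 : 0 < s.
Let a := s * n%:R.
Let l : seq (R * nat * R) := [:: (1, 1%N, s)].
(** In terms of rho, [q1] and [q2] are the decay exponents of the two contributions to j^2 / M, from
    the gradient and from the time derivative; exceeding 1 means integrability in x. *)
Let q1 := 6 - a * m - 2 * a.
Let q2 := 2 * n%:R + a * m - 2 - 2 * a.
Hypotheses (q1_gt1 : 1 < q1) (q2_gt1 : 1 < q2).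

Lemma film_ge (e x : R) : 0 < e -> (e + x ^+ n) `^ s <= film n s e x.
Proof.
move=> e0; rewrite filmE// lerDl; apply: mulr_ge0; first by rewrite mulr_ge0// ltW.
by rewrite mulr_ge0 ?powR_ge0// even_expr_ge0.
Qed.

Lemma film_gt0 (e x : R) : 0 < e -> 0 < film n s e x.
Proof.
move=> e0; apply: (lt_le_trans _ (film_ge e x e0)).
by apply: powR_gt0; exact: base_gt0.
Qed.

Lemma film_le (e x : R) : 0 < e -> film n s e x <= (1 + a) * (e + x ^+ n) `^ s.
Proof.
move=> e0; rewrite filmE// mulrDl mul1r lerD2l; apply: ler_wpM2l;
  first by rewrite mulr_ge0// ltW.
have w0 := @base_gt0 R n n_even e x e0.
by rewrite -(mulr_powRB1 (ltW w0) s_gt0) ler_wpM2r ?powR_ge0// lerDr ltW.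
Qed.

(** [e'] stands for the time derivative of eps. The list [l], not [dx n l], appears under [de],
    since K is the primitive of the time derivative. *)
Definition film_flux (e e' x : R) : R :=
  - (power_mobility m (film n s e x) * (film n s e)^`(3)%classic x
     + e' * msum n (de l) e x).

Lemma is_derive_film_flux (e e' x : R) : 0 < e ->
  is_derive x 1 (film_flux e e')
   (- (e' * msum n (de (dx n l)) e x + grad_energy (power_mobility m) (film n s e) x)).
Proof.
move=> e0.
have dK := is_derive_msum_x n n_even (de l) e x e0.
pose G (x : R) := power_mobility m (film n s e x) * (film n s e)^`(3)%classic x.
have dG : derivable G x 1.
  apply: derivableM.
    by have [] := @is_derive1_comp R (power_mobility m) (film n s e) x _ _
      (is_derive1_powR m (film_gt0 e x e0)) (is_derive_msum_x n n_even (dx n l) e x e0).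
  rewrite derive1n_msum//.
  by have [] := is_derive_msum_x n n_even (iter 3 (dx n) (dx n l)) e x e0.
have dG' : is_derive x 1 G (grad_energy (power_mobility m) (film n s e) x).
  by rewrite /grad_energy derive1E; exact: derivableP.
rewrite -dx_de addrC.
exact: (is_deriveN (is_deriveD dG' (is_deriveZ e' dK))).
Qed.

Lemma film_flux_bound : exists2 C : R, 0 <= C & forall e e' x : R, 0 < e ->
  (film_flux e e' x) ^+ 2 / power_mobility m (film n s e x) <=
  C * (e + x ^+ n) `^ (- q1 / n%:R) + C * e' ^+ 2 * (e + x ^+ n) `^ (- q2 / n%:R).
Proof.
pose A := \sum_(z <- iter 3 (dx n) (dx n l)) `|z.1.1|.
pose B := \sum_(z <- de l) `|z.1.1|.
pose D := (1 + a) `^ `|m|.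
have A0 : 0 <= A by rewrite /A sumr_ge0.
have B0 : 0 <= B by rewrite /B sumr_ge0.
have D0 : 0 <= D by exact: powR_ge0.
exists (2 * D * A ^+ 2 + 2 * D * B ^+ 2).
  by rewrite addr_ge0// !mulr_ge0// sqr_ge0.
move=> e e' x e0.
have w0 := @base_gt0 R n n_even e x e0.
have h0 := film_gt0 e x e0.
rewrite /film_flux derive1n_msum//.
(* The antiderivative has weight 1 + a. Four applications of [dx], one for the film and three for
   its third derivative, lower it to a - 3, while [de] gives 1 + a - n. *)
have hl : homog n (1 + n%:R * s) l by rewrite /homog /= eqxx orbT.
have hA := msum_bound n n_gt0 n_even _ _ e x e0
  (homog_dx n n_gt0 _ _ (homog_dx n n_gt0 _ _ (homog_dx n n_gt0 _ _
    (homog_dx n n_gt0 _ _ hl)))).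
have hB := msum_bound n n_gt0 n_even _ _ e x e0 (homog_de n _ _ hl).
have sqr_bound (X c p : R) : 0 <= c -> `|X| <= c * (e + x ^+ n) `^ p ->
    X ^+ 2 <= c ^+ 2 * (e + x ^+ n) `^ (p * 2).
  move=> c0 Xc; rewrite powRrM powR_mulrn ?powR_ge0// -exprMn -(real_normK
    (num_real X)).
  by apply: lerXn2r; rewrite ?nnegrE ?mulr_ge0 ?powR_ge0.
(* Used with p = m and p = -m: the same [D] bounds the mobility and its reciprocal. *)
have pow_bound (p : R) : `|p| = `|m| ->
    film n s e x `^ p <= D * (e + x ^+ n) `^ (s * p).
  move=> pm; rewrite powRrM /D -pm; apply: powR_comparable.
  - by rewrite lerDl mulr_ge0// ltW.
  - exact: powR_gt0.
  - exact: film_ge.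
  - exact: film_le.
have {}hA := sqr_bound _ _ _ A0 hA.
have {}hB := sqr_bound _ _ _ B0 hB.
have hM := pow_bound m erefl.
have := pow_bound (- m) (normrN m); rewrite powRN => hMV.
have M0 : 0 < film n s e x `^ m by exact: powR_gt0.
rewrite /power_mobility.
move: hA hB hM hMV M0.
set X := msum _ _ _ _; set Y := msum _ _ _ _; set M := film n s e x `^ m.
move=> hA hB hM hMV M0.
have w_neq0 : e + x ^+ n != 0 by rewrite gt_eqF.
have wD p q : (e + x ^+ n) `^ p * (e + x ^+ n) `^ q = (e + x ^+ n) `^ (p + q).
  by rewrite powRD// w_neq0 implybT.
(* This is (P + Q)^2 <= 2 P^2 + 2 Q^2 divided by [M]. *)
have split_le : (- (M * X + e' * Y)) ^+ 2 / M <=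
    2 * (M * X ^+ 2) + 2 * e' ^+ 2 * (M^-1 * Y ^+ 2).
  rewrite ler_pdivrMr//.
  rewrite [leRHS](_ : _ = 2 * (M * X) ^+ 2 + 2 * (e' * Y) ^+ 2).
    rewrite -subr_ge0 [leRHS](_ : _ = (M * X - e' * Y) ^+ 2); last by ring.
    exact: sqr_ge0.
  by have : M != 0 by [rewrite gt_eqF]; move=> ?; field.
apply: (le_trans split_le).
have MX : M * X ^+ 2 <= D * A ^+ 2 * (e + x ^+ n) `^ (- q1 / n%:R).
  rewrite [leRHS](_ : _ = (D * (e + x ^+ n) `^ (s * m)) * (A ^+ 2 *
    (e + x ^+ n) `^ ((1 + n%:R * s - 1 - 1 - 1 - 1) / n%:R * 2))).
    by apply: ler_pM => //; [exact: ltW|exact: sqr_ge0].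
  rewrite mulrACA wD; congr (_ * _ `^ _); rewrite /q1 /a; field.
  by rewrite gt_eqF.
have MY : M^-1 * Y ^+ 2 <= D * B ^+ 2 * (e + x ^+ n) `^ (- q2 / n%:R).
  rewrite [leRHS](_ : _ = (D * (e + x ^+ n) `^ (s * - m)) * (B ^+ 2 *
    (e + x ^+ n) `^ ((1 + n%:R * s - n%:R) / n%:R * 2))).
    by apply: ler_pM => //; [rewrite invr_ge0 ltW|exact: sqr_ge0].
  rewrite mulrACA wD; congr (_ * _ `^ _); rewrite /q2 /a; field.
  by rewrite gt_eqF.
apply: lerD.
  apply: (@le_trans _ _ (2 * (D * A ^+ 2 * (e + x ^+ n) `^ (- q1 / n%:R))));
    first by rewrite ler_pM2l.
  rewrite !mulrA ler_wpM2r ?powR_ge0// lerDl !mulr_ge0// sqr_ge0.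
apply: (@le_trans _ _ (2 * e' ^+ 2 * (D * B ^+ 2 * (e + x ^+ n) `^ (- q2 / n%:R)))).
  by rewrite ler_wpM2l// mulr_ge0// sqr_ge0.
rewrite mulrA ler_wpM2r ?powR_ge0//.
rewrite [leLHS](_ : _ = 2 * D * B ^+ 2 * e' ^+ 2); last by ring.
by rewrite ler_wpM2r ?sqr_ge0// lerDr !mulr_ge0// sqr_ge0.
Qed.

Lemma metric_tensor_film_le : exists2 C : R, 0 <= C & forall e e' : R, 0 < e ->
  (metric_tensor (power_mobility m) (film n s e)
    (fun x => e' * msum n (de (dx n l)) e x + grad_energy (power_mobility m)
      (film n s e) x)%R
   <= (C * (e `^ ((1 - q1) / n%:R) + e' ^+ 2 * e `^ ((1 - q2) / n%:R)))%:E)%E.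
Proof.
have [C C0 HC] := film_flux_bound.
pose K q : R := 2 `^ q * (2 * (q - 1)^-1).
have K0 q : 1 < q -> 0 <= K q.
  by move=> q1'; rewrite !mulr_ge0 ?powR_ge0// invr_ge0 subr_ge0 ltW.
exists (C * (K q1 + K q2)); first by rewrite mulr_ge0// addr_ge0 ?K0.
move=> e e' e0.
apply: (@le_trans _ _ (\int[mu]_x ((film_flux e e' x) ^+ 2 / power_mobility m
  (film n s e x))%:E)%E).
  apply: ereal_inf_lbound; exists (film_flux e e') => //= x.
  exact: is_derive_film_flux.
pose f q x := (e + x ^+ n) `^ (- q / n%:R).
have mf q : measurable_fun setT (EFin \o f q).
  apply/measurable_EFinP; apply: continuous_measurable_fun.
  exact: continuous_powR_base.
have f0 q x : (0 <= (f q x)%:E)%E by rewrite lee_fin powR_ge0.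
apply: (@le_trans _ _ (\int[mu]_x (C%:E * (f q1 x)%:E + (C * e' ^+ 2)%:E *
  (f q2 x)%:E))%E).
  apply: ge0_le_integral_nonmeasurable => x _.
    by rewrite lee_fin mulr_ge0 ?sqr_ge0// invr_ge0 powR_ge0.
  by rewrite -!EFinM -EFinD lee_fin HC.
have Ce0 : 0 <= C * e' ^+ 2 by rewrite mulr_ge0// sqr_ge0.
rewrite ge0_integralD//; last 4 first.
- by move=> x _; rewrite mule_ge0// lee_fin.
- by apply: measurable_funeM; exact: mf.
- by move=> x _; rewrite mule_ge0// lee_fin.
- by apply: measurable_funeM; exact: mf.
rewrite ge0_integralZl_EFin//; last exact: mf.
rewrite ge0_integralZl_EFin//; last exact: mf.
have I q : 1 < q -> (\int[mu]_x (f q x)%:E <= (K q * e `^ ((1 - q) / n%:R))%:E)%E.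
  move=> q1'; apply: (le_trans (integral_powR_base_le q e q1' e0)).
  by rewrite lee_fin /K le_eqVlt; apply/orP; left; apply/eqP; ring.
apply: (@le_trans _ _ (C%:E * (K q1 * e `^ ((1 - q1) / n%:R))%:E + (C * e' ^+ 2)%:E *
  (K q2 * e `^ ((1 - q2) / n%:R))%:E)%E).
  by apply: leeD; apply: lee_wpmul2l; rewrite ?lee_fin//; exact: I.
rewrite -!EFinM -EFinD lee_fin.
set E1 := e `^ _; set E2 := e `^ _.
have E10 : 0 <= E1 by exact: powR_ge0.
have E20 : 0 <= E2 by exact: powR_ge0.
have K10 := K0 _ q1_gt1; have K20 := K0 _ q2_gt1.
(* The two sides differ by the nonnegative cross terms introduced by the common constant
   [K q1 + K q2]. *)
rewrite -subr_ge0 [leRHS](_ : _ = C * (K q2 * E1) + (C * e' ^+ 2) * (K q1 * E2));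
  last by ring.
by rewrite addr_ge0// mulr_ge0// mulr_ge0.
Qed.

End Bound.
End Cost.

(** * The touchdown curve: regularity, minima and finite rate *)

Section Curve.
Context {R : realType}.

(** [beta] is the exponent n b of eps in tau. *)
Definition touchdown (n : nat) (s beta t : R) : R -> R := film n s ((- t) `^ beta).

Variable n : nat.
Hypotheses (n_gt0 : (0 < n)%N) (n_even : ~~ odd n).
Variables (s T beta : R).
Hypotheses (s_gt0 : 0 < s) (s_le1 : s <= 1) (T_gt0 : 0 < T) (beta_gt0 : 0 < beta).

Let eps (t : R) : R := (- t) `^ beta.
Let deps (t : R) : R := - (beta * (- t) `^ (beta - 1)).

Let eps_gt0 (t : R) : t < 0 -> 0 < eps t.
Proof. by move=> t0; rewrite powR_gt0// oppr_gt0. Qed.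

Let eps0 : eps 0 = 0.
Proof. by rewrite /eps oppr0 powR0// gt_eqF. Qed.

Let n_gt0R : 0 < n%:R :> R. Proof. by rewrite ltr0n. Qed.

Lemma film_ge0 (e x : R) : 0 <= film n s e x.
Proof.
rewrite filmE// addr_ge0 ?powR_ge0//; apply: mulr_ge0.
  by rewrite mulr_ge0// ltW.
by rewrite mulr_ge0 ?powR_ge0// even_expr_ge0.
Qed.

Lemma film_at0 (e : R) : film n s e 0 = e `^ s.
Proof. by rewrite filmE// expr0n gtn_eqF//= mul0r mulr0 !addr0. Qed.

Lemma film_curve_touchdown : film_curve T (touchdown n s beta).
Proof.
split.
- by move=> t x _; exact: film_ge0.
- apply: (@locally_uniform_of_holder R T s (1 + s * n%:R) eps) => //.
  + by rewrite addr_ge0// mulr_ge0// ltW.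
  + exact: within_continuous_powR_opp.
  + by move=> t t' x _ _; apply: film_holder => //; exact: powR_ge0.
- by move=> t x /andP[_ t0]; apply: film_gt0 => //; exact: eps_gt0.
- apply: (@smooth_film R n n_even T eps deps (dx n [:: (1, 1%N, s)])) => //.
  + by move=> t t0; exact: is_derive_powR_opp.
  + move=> t t0.
    rewrite (_ : deps = cst (- beta) * (fun u => (- u) `^ (beta - 1))); last first.
      by apply/funext => u; rewrite /deps -mulNr.
    apply: (@continuousM R R (cst (- beta))); first exact: cvg_cst.
    exact: continuous_powR_opp.
Qed.

Lemma min_touchdown_initial : exists2 v : R, 0 < v & min_value (touchdown n s beta
  (- T)) v.
Proof.
have e0 : 0 < eps (- T) by rewrite eps_gt0// oppr_lt0.
exists (eps (- T) `^ s); first by rewrite powR_gt0.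
split; first by exists 0 => //; rewrite /touchdown -/(eps _) film_at0.
move=> _ [x _ <-]; apply: le_trans (film_ge n n_gt0 n_even s s_gt0 (eps (- T)) x e0).
apply: ge0_ler_powR; rewrite ?nnegrE ?lerDl ?even_expr_ge0//; apply: ltW => //.
exact: base_gt0.
Qed.

Lemma min_touchdown_terminal : min_value (touchdown n s beta 0) 0.
Proof.
split; first by exists 0 => //; rewrite /touchdown -/(eps _) eps0 film_at0 powR0//
  gt_eqF.
by move=> _ [x _ <-]; exact: film_ge0.
Qed.

Lemma time_derivative_touchdown (t x : R) : - T <= t < 0 ->
  time_derivative T (touchdown n s beta) t x =
    deps t * msum n (de (dx n [:: (1, 1%N, s)])) (eps t) x.
Proof.
move=> tT; apply: time_derivativeE => //.
apply: (@is_derive_film_t R n n_even eps deps) => //.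
  by move=> u u0; exact: is_derive_powR_opp.
by case/andP: tT.
Qed.

(** The last two equations say that eps^((1 - q1)/n) and eps'^2 eps^((1 - q2)/n) are both multiples
    of tau^r, so r > -1 suffices for integrability in time. *)
Lemma rate_functional_touchdown (m r q1 q2 : R) :
  q1 = 6 - s * n%:R * m - 2 * (s * n%:R) ->
  q2 = 2 * n%:R + s * n%:R * m - 2 - 2 * (s * n%:R) ->
  1 < q1 -> 1 < q2 -> -1 < r ->
  beta * ((1 - q1) / n%:R) = r -> 2 * (beta - 1) + beta * ((1 - q2) / n%:R) = r ->
  (rate_functional (power_mobility m) T (touchdown n s beta) < +oo)%E.
Proof.
move=> q1E q2E q1_gt1 q2_gt1 r_gt r1 r2.
have [C C0 HC] := @metric_tensor_film_le R n n_gt0 n_even m s s_gt0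
   ltac:(by rewrite -q1E) ltac:(by rewrite -q2E).
rewrite -q1E -q2E in HC.
rewrite /rate_functional lte_mul_pinfty//.
(* The factor beta^2 comes from the square of the derivative of tau^beta. *)
pose c := C * (1 + beta ^+ 2).
have c0 : 0 <= c by rewrite mulr_ge0// addr_ge0// sqr_ge0.
apply: (@le_lt_trans _ _ (\int[lebesgue_measure]_(t in `[(- T)%R, 0%R[) (c%:E *
  ((- t) `^ r)%:E))%E); last first.
  rewrite ge0_integralZl_EFin//; last 2 first.
  - by move=> t _; rewrite lee_fin powR_ge0.
  - apply/measurable_EFinP; apply: measurable_funTS.
    apply: (@measurableT_comp _ _ _ _ _ _ (@powR R ^~ r)); first exact: measurable_powR.
    exact: oppr_measurable.
  apply: (le_lt_trans (lee_wpmul2l _ (integral_powR_time_le T r T_gt0 r_gt)));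
    first by rewrite lee_fin.
  by rewrite -EFinM ltry.
apply: ge0_le_integral_nonmeasurable => t /=; rewrite in_itv/= => tT.
  apply: le_ereal_inf_tmp => _ [j _ <-]; apply: integral_ge0 => x _.
  by rewrite lee_fin mulr_ge0 ?sqr_ge0// invr_ge0 powR_ge0.
have t0 : t < 0 by case/andP: tT.
have nt0 : - t != 0 by rewrite oppr_eq0 lt_eqF.
rewrite (_ : (fun x => _) = (fun x => deps t *
  msum n (de (dx n [:: (1, 1%N, s)])) (eps t) x +
   grad_energy (power_mobility m) (film n s (eps t)) x)); last first.
  by apply/funext => x; rewrite time_derivative_touchdown.
apply: (le_trans (HC (eps t) (deps t) (eps_gt0 t t0))).
rewrite lee_fin le_eqVlt; apply/orP; left; apply/eqP.
rewrite /c -(mulrA C); congr (C * _); rewrite [RHS]mulrDl mul1r; congr (_ + _).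
  by rewrite /eps -powRrM r1.
rewrite /deps /eps sqrrN exprMn -mulrA; congr (_ * _).
rewrite -powR_mulrn ?powR_ge0// -!powRrM -powRD ?nt0 ?implybT//.
by rewrite -r2 mulrC.
Qed.

End Curve.

(** * Choice of the parameters *)

Theorem proposition10p1 (R : realType) (m T : R) (hm : m < 8) (hT : 0 < T) :
  exists h : R -> R -> R,
    [/\ film_curve T h,
        (rate_functional (power_mobility m) T h < +oo)%E,
        exists2 v : R, 0 < v & min_value (h (- T)) v &
        min_value (h 0) 0].
Proof.
(* This is the tangent at m = 8 to the convex function 5 / (m + 2) on m > -2: it stays below the
   curve and exceeds 1/2 for m < 8. *)
pose a : R := (18 - m) / 20.
(* Doubling makes n even; n > a gives s < 1, and n > 3 + 2 a - a m gives q2 > 1. *)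
pose n := (Num.truncn (`|3 + 2 * a - a * m| + a)).+1.*2.
have n_gt0 : (0 < n)%N by [].
have n_even : ~~ odd n by rewrite odd_double.
have a_gt0 : 0 < a by rewrite divr_gt0//; lra.
have n_big : `|3 + 2 * a - a * m| + a < n%:R.
  apply: (lt_le_trans (truncnS_gt _)).
  by rewrite ler_nat /n -addnn leq_addr.
have n0 : 0 < n%:R :> R by rewrite ltr0n.
have a_lt : a < n%:R by apply: le_lt_trans n_big; rewrite lerDr.
have c_lt : 3 + 2 * a - a * m < n%:R.
  apply: le_lt_trans n_big; apply: (le_trans (ler_norm _)).
  by rewrite lerDl ltW.
(* This is 1 / (4 - a m), the value that makes the two powers of tau coincide. *)
pose b : R := 20 / ((8 - m) * (10 - m)).
have m8 : 8 - m != 0 by rewrite subr_eq0 gt_eqF.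
have m10 : 10 - m != 0 by rewrite subr_eq0 gt_eqF//; lra.
have b_gt0 : 0 < b by rewrite divr_gt0// mulr_gt0//; lra.
have n_neq0 : n%:R != 0 :> R by rewrite gt_eqF.
have sn : a / n%:R * n%:R = a by rewrite divfK.
have s_gt0 : 0 < a / n%:R by rewrite divr_gt0.
have s_le1 : a / n%:R <= 1 by rewrite ler_pdivrMr// mul1r ltW.
have beta_gt0 : 0 < n%:R * b by rewrite mulr_gt0.
exists (touchdown n (a / n%:R) (n%:R * b)); split.
- exact: film_curve_touchdown.
- apply: (@rate_functional_touchdown R n n_gt0 n_even (a / n%:R) T (n%:R *
  b) s_gt0 hT m (- ((8 - m) / (10 - m)))
     (6 - a * m - 2 * a) (2 * n%:R + a * m - 2 - 2 * a)); rewrite ?sn//.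
  (* Here q1 - 1 = 5 - a (m + 2), and 100 - (18 - m)(m + 2) is a perfect square. *)
  + rewrite -subr_gt0 (_ : _ - _ = (8 - m) ^+ 2 / 20); last by rewrite /a; field.
    by rewrite divr_gt0// exprn_gt0// subr_gt0.
  + have : 0 < n%:R :> R by []. lra.
  + rewrite ltrN2 ltr_pdivrMr; lra.
  + rewrite /b /a; field; by rewrite ?m8 ?m10 ?n_neq0.
  + rewrite /b /a; field; by rewrite ?m8 ?m10 ?n_neq0.
- exact: min_touchdown_initial.
- exact: min_touchdown_terminal.
Qed.
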